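(* For integers $n,m\ge 1$ let $G_{n,m}$ be the graph on $n+m+3$ vertices $u,v,w,x_1,\ldots,x_n,y_1,\ldots,y_m$ whose edges are $ux_i$ and $x_iv$ for $1\le i\le n$, and $vy_j$ and $y_jw$ for $1\le j\le m$. Consider the arc-reversal walk on $G_{n,m}$. For all $n,m\ge1$ there is peak state transfer from $u$ to $w$ at time $4$, with $$|B_4(u,w)|=\sum_{\theta}|E_\theta(u,w)|=\frac{2\sqrt{nm}}{n+m}.$$ If $n=m$, this is perfect state transfer. For the graphs $G_{n,n+1}$ one has $$B_4(u,w)=\sqrt{1-\frac{1}{(2n+1)^2}},$$ so that $B_4(u,w)$ converges to $1$ as $n\to\infty$.
   Context: Arc-reversal walk: let $G=(V,E)$ be a finite simple graph without isolated vertices and $\mathcal{A}$ its set of arcs (ordered pairs $(x,y)$ with $xy\in E$; $x$ is the tail). Let $N\in\mathbb{R}^{\mathcal{A}\times V}$ with $N(a,x)=1/\sqrt{d(x)}$ if $x$ is the tail of $a$ and $0$ otherwise ($d(x)$ is the degree), and let $R$ be the permutation matrix on $\mathcal{A}$ swapping $(x,y)$ and $(y,x)$. The transition matrix is $U=R(2NN^T-I)$. Put $B_t=N^TU^tN$ for integers $t\ge0$, and $B=B_1=D^{-1/2}AD^{-1/2}$, where $A$ is the adjacency matrix and $D$ the diagonal degree matrix. Let $B=\sum_\theta\theta E_\theta$ be the spectral decomposition ($\theta$ over distinct eigenvalues, $E_\theta$ the orthogonal projection onto the $\theta$-eigenspace). For distinct vertices $x,y$ there is peak state transfer from $x$ to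 $y$ at time $t$ (a positive integer) if $|B_t(x,y)|=\sum_\theta|E_\theta(x,y)|$ and $E_\theta(x,y)\neq0$ for at least one $\theta$. There is perfect state transfer from $x$ to $y\neq x$ at time $t$ if $U^tN\mathbf{e}_x=\gamma N\mathbf{e}_y$ for some $\gamma\in\mathbb{C}$ with $|\gamma|=1$ (equivalently $|B_t(x,y)|=1$). *)

(* Defs.v *)
From HB Require Import structures.
From mathcomp Require Import all_boot all_order all_algebra.
From mathcomp Require Import complex.
From mathcomp Require Import all_classical all_reals all_analysis.

Set Implicit Arguments.
Unset Strict Implicit.
Unset Printing Implicit Defensive.

Import Order.TTheory GRing.Theory Num.Theory.
Import numFieldNormedType.Exports.
Local Open Scope ring_scope.

Record sgraph := SGraph {
  vertex :> finType;
  adj : rel vertex;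
  adj_sym : symmetric adj;
  adj_irrefl : irreflexive adj }.

Definition deg (G : sgraph) (x : G) : nat := #|[set y : G | adj x y]|.

(* An arc is a pair (tail, head) of adjacent vertices. *)
Definition garc (G : sgraph) : finType := {a : G * G | adj a.1 a.2}.

(* Matrices indexed by finite types are indexed through enum_val / enum_rank. *)
Section Walk.
Variables (R : realType) (G : sgraph).

Definition tail_mx : 'M[R]_(#|garc G|, #|G|) :=
  \matrix_(i, j) if (val (enum_val i)).1 == enum_val j
                 then (Num.sqrt (deg (enum_val j))%:R)^-1 else 0.

Definition reversal_mx : 'M[R]_(#|garc G|) :=
  \matrix_(i, j) (val (enum_val i) ==
                  ((val (enum_val j)).2, (val (enum_val j)).1))%:R.

Definition transition_mx : 'M[R]_(#|garc G|) :=
  reversal_mx *m (2%:R *: (tail_mx *m tail_mx^T) - 1%:M).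

Definition walk_mx (t : nat) : 'M[R]_(#|G|) :=
  tail_mx^T *m (transition_mx ^+ t) *m tail_mx.

Definition walk_entry (t : nat) (x y : G) : R :=
  walk_mx t (enum_rank x) (enum_rank y).

(* Projection onto the eigenspace of B = walk_mx 1 along its orthogonal
   complement for the standard inner product: the row kernel of W^T consists of
   the row vectors orthogonal to every row of W. Row and column eigenvectors
   agree since B is symmetric (see walk_entry1). *)
Definition eigenproj (theta : R) : 'M[R]_(#|G|) :=
  let W := eigenspace (walk_mx 1) theta in proj_mx W (kermx W^T).

Definition eigenproj_entry (theta : R) (x y : G) : R :=
  eigenproj theta (enum_rank x) (enum_rank y).

Definition eigenproj_sum (x y : G) : R :=
  \sum_(theta \in [set theta | eigenvalue (walk_mx 1) theta]%classic)
    (`|eigenproj_entry theta x y| : R).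

Definition peak_state_transfer (x y : G) (t : nat) : Prop :=
  [/\ x != y, (0 < t)%N, `|walk_entry t x y| = eigenproj_sum x y &
      exists2 theta, eigenvalue (walk_mx 1) theta &
                     eigenproj_entry theta x y != 0].

Definition vertex_vec (x : G) : 'cV[R]_(#|G|) := delta_mx (enum_rank x) 0.

Definition perfect_state_transfer (x y : G) (t : nat) : Prop :=
  x != y /\
  exists2 gamma : R[i], `|gamma| = 1 &
    map_mx (real_complex R) (transition_mx ^+ t *m tail_mx *m vertex_vec x)
    = gamma *: map_mx (real_complex R) (tail_mx *m vertex_vec y).

End Walk.

Section WalkTheory.
Variables (R : realType) (G : sgraph).
Local Notation N := (tail_mx R G).

Lemma tail_mx_enum (a : garc G) (x : G) : N (enum_rank a) (enum_rank x) =
  ((val a).1 == x)%:R / Num.sqrt (deg x)%:R.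
Proof. by rewrite mxE !enum_rankK; case: eqP; rewrite ?mul1r ?mul0r. Qed.

Lemma card_tail_deg (x : G) : #|[pred a : garc G | (val a).1 == x]| = deg x.
Proof.
have vi (a b : garc G) : (val a).1 = (val b).1 -> (val a).2 = (val b).2 -> a = b.
  by move=> h1 h2; apply: val_inj; rewrite /= (surjective_pairing (val a)) h1 h2 -surjective_pairing.
rewrite /deg -(card_in_imset (f := fun a : garc G => (val a).2)).
  apply: eq_card => y; rewrite [RHS]inE; apply/imsetP/idP.
    by move=> [a]; rewrite inE /= => /eqP <- ->; exact: (valP a).
  by move=> e; exists (exist (fun a : G * G => adj a.1 a.2) (x, y) e); rewrite ?inE /=.
by move=> a b; rewrite !inE => /eqP h1 /eqP h2 h; apply: vi => //; rewrite h1 h2.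
Qed.

Hypothesis noiso : forall x : G, (0 < deg x)%N.

Lemma tail_mx_orthonormal : N^T *m N = 1%:M.
Proof.
apply/matrixP => i j; rewrite -(enum_valK i) -(enum_valK j); set x := enum_val i; set y := enum_val j.
rewrite !mxE (reindex (@enum_rank (garc G))) /=; last exact/onW_bij/enum_rank_bij.
under eq_bigr do rewrite mxE !tail_mx_enum.
rewrite (inj_eq enum_rank_inj); case: eqP => [<-|/eqP nxy].
  rewrite (eq_bigr (fun a : garc G => ((val a).1 == x)%:R * (deg x)%:R^-1)); last first.
    move=> a _; case: eqP => _; rewrite ?mul0r // !mul1r -invfM -expr2 sqr_sqrtr //.
  have E : \sum_(a : garc G) ((val a).1 == x)%:R = (deg x)%:R :> R.
    rewrite -natr_sum -card_tail_deg -sum1_card [in RHS]big_mkcond; congr (_%:R); apply: eq_bigr => a _; rewrite inE /=; by case: eqP.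
  rewrite -mulr_suml E.
  by rewrite divff // pnatr_eq0 -lt0n.
rewrite big1 // => a _; case: eqP => [->|]; last by rewrite !mul0r.
by rewrite (negPf nxy) !mul0r mulr0.
Qed.

Lemma walk_entry1 (x y : G) : walk_entry R 1 x y = (adj x y)%:R / (Num.sqrt (deg x)%:R * Num.sqrt (deg y)%:R).
Proof.
rewrite /walk_entry /walk_mx expr1 /transition_mx.
have -> : N^T *m (reversal_mx R G *m (2%:R *: (N *m N^T) - 1%:M)) *m N = N^T *m reversal_mx R G *m N.
  rewrite mulmxA -!mulmxA; congr (_ *m (_ *m _)).
  rewrite mulmxBl mul1mx -scalemxAl -mulmxA tail_mx_orthonormal mulmx1 scaler_nat mulr2n addrK //.
rewrite -mulmxA mxE (reindex (@enum_rank (garc G))) /=; last exact/onW_bij/enum_rank_bij.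
have RN a : (reversal_mx R G *m N) (enum_rank a) (enum_rank y) = ((val a).2 == y)%:R / Num.sqrt (deg y)%:R.
  have ea : adj (val a).2 (val a).1 by rewrite adj_sym; exact: (valP a).
  pose b : garc G := exist (fun a : G * G => adj a.1 a.2) ((val a).2, (val a).1) ea.
  rewrite mxE (bigD1 (enum_rank b)) //= big1 ?addr0.
    by rewrite tail_mx_enum !mxE !enum_rankK /= -surjective_pairing eqxx mul1r.
  move=> k kb; rewrite mxE enum_rankK; case: eqP => [e|]; last by rewrite mul0r.
  case/eqP: kb; rewrite -(enum_valK k); congr enum_rank; apply: val_inj; rewrite /= e /=.
  by rewrite -surjective_pairing.
under eq_bigr do rewrite RN mxE tail_mx_enum.
case: (boolP (adj x y)) => exy.
  pose b : garc G := exist (fun a : G * G => adj a.1 a.2) (x, y) exy.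
  rewrite (bigD1 b) //= big1 ?addr0; first by rewrite !eqxx !mul1r invfM.
  move=> a ab; case: eqP => [e1|]; last by rewrite !mul0r.
  case: eqP => [e2|]; last by rewrite !mul0r mulr0.
  by case/eqP: ab; apply: val_inj; rewrite /= -e1 -e2 -surjective_pairing.
rewrite mul0r big1 // => a _.
case: eqP => [e1|]; last by rewrite !mul0r.
case: eqP => [e2|]; last by rewrite !mul0r mulr0.
by case/negP: exy; rewrite -e1 -e2; exact: (valP a).
Qed.

Lemma capmx_kermx_tr p n (W : 'M[R]_(p, n)) : (W :&: kermx W^T = 0)%MS.
Proof.
apply/eqP; rewrite -submx0; apply/rV_subP => v; rewrite sub_capmx => /andP[/submxP[c vE] /sub_kermxP h].
have vv0 : v *m v^T = 0 by rewrite {2}vE trmx_mul mulmxA h mul0mx.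
rewrite submx0; apply/eqP/rowP => i; rewrite [RHS]mxE.
move/matrixP/(_ 0 0)/eqP: vv0; rewrite [X in X == _]mxE [X in _ == X]mxE psumr_eq0.
  by move/allP/(_ i (mem_index_enum _)); rewrite /= mxE mulf_eq0 orbb => /eqP.
by move=> j _; rewrite mxE -expr2 sqr_ge0.
Qed.

Lemma addsmx_kermx_tr_full p n (W : 'M[R]_(p, n)) : row_full (W + kermx W^T)%MS.
Proof.
rewrite /row_full; apply/eqP.
have := mxrank_sum_cap W (kermx W^T); rewrite capmx_kermx_tr mxrank0 addn0 => ->.
by rewrite mxrank_ker mxrank_tr subnKC // rank_leq_col.
Qed.

Lemma eigenproj_id th (u : 'rV[R]_#|G|) : (u <= eigenspace (walk_mx R G 1) th)%MS -> u *m eigenproj G th = u.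
Proof. by move=> h; rewrite proj_mx_id // capmx_kermx_tr. Qed.

Lemma eigenproj_0 th (u : 'rV[R]_#|G|) : (forall v : 'rV_#|G|, v *m walk_mx R G 1 = th *: v -> u *m v^T = 0) -> u *m eigenproj G th = 0.
Proof.
move=> h; rewrite proj_mx_0 ?capmx_kermx_tr //; apply/sub_kermxP.
apply/trmx_inj; rewrite trmx_mul trmxK trmx0; apply/row_matrixP => i.
rewrite row_mul row0; apply/trmx_inj; rewrite trmx_mul trmxK trmx0.
by apply: h; apply/eigenspaceP; rewrite row_sub.
Qed.
End WalkTheory.

Definition Gvert (n m : nat) : finType := ('I_3 + ('I_n + 'I_m))%type.

Definition vu {n m} : Gvert n m := inl (@Ordinal 3 0 isT).
Definition vv {n m} : Gvert n m := inl (@Ordinal 3 1 isT).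
Definition vw {n m} : Gvert n m := inl (@Ordinal 3 2 isT).
Definition vx {n m} (i : 'I_n) : Gvert n m := inr (inl i).
Definition vy {n m} (j : 'I_m) : Gvert n m := inr (inr j).

Definition Gadj_half (n m : nat) (a b : Gvert n m) : bool :=
  match b with
  | inr (inl _) => (a == vu) || (a == vv)
  | inr (inr _) => (a == vv) || (a == vw)
  | inl _ => false
  end.

Definition Gadj (n m : nat) : rel (Gvert n m) :=
  fun a b => Gadj_half a b || Gadj_half b a.

Lemma Gadj_sym n m : symmetric (@Gadj n m).
Proof. by move=> a b; rewrite /Gadj orbC. Qed.

Lemma Gadj_irrefl n m : irreflexive (@Gadj n m).
Proof. by case=> [?|[?|?]]. Qed.

Definition Ggraph (n m : nat) : sgraph := SGraph (@Gadj_sym n m) (@Gadj_irrefl n m).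

(* The walk is meant for graphs without isolated vertices. *)
Lemma Ggraph_deg_gt0 n m (x : Ggraph n m) : (0 < n)%N -> (0 < m)%N -> (0 < deg x)%N.
Proof.
move=> n0 m0; apply/card_gt0P.
case: x => [[[|[|[|//]]] h]|[i|j]].
- by exists (vx (Ordinal n0)); rewrite inE.
- by exists (vx (Ordinal n0)); rewrite inE.
- by exists (vy (Ordinal m0)); rewrite inE.
- by exists vu; rewrite inE.
- by exists vw; rewrite inE.
Qed.

(* Main.v *)
Require Import Defs.
From mathcomp Require Import all_boot all_order all_algebra.
From mathcomp Require Import ring.
From mathcomp Require Import complex.
From mathcomp Require Import all_classical all_reals all_analysis.
Import Order.TTheory GRing.Theory Num.Theory.
Import numFieldNormedType.Exports.
Local Open Scope classical_set_scope.
Local Open Scope ring_scope.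

(** The matrices $B_t$ satisfy the Chebyshev recurrence
    $B_{t+2} = 2 B B_{t+1} - B_t$ ([walk_mxSS]), hence $B_t = T_t(B)$, and
    $B_4$ acts on the $\theta$-eigenspace of $B$ as
    $T_4(\theta) = 8\theta^4 - 8\theta^2 + 1$ ([mulmx_walk4]).

    Write $\mathbf e_u = \sum_\theta v_\theta$ with $v_\theta$ a row
    eigenvector of $B$ for $\theta$.  Since $B$ is symmetric, distinct
    eigenspaces are orthogonal, so $E_\theta(u,w) = v_\theta(w)$
    ([eigenproj_entry_mem]); therefore $\sum_\theta |E_\theta(u,w)|$ is
    $\sum_\theta |v_\theta(w)|$ ([eigenproj_sumE]) and $B_4(u,w)$ is
    $\sum_\theta T_4(\theta) v_\theta(w)$ ([walk_entry4E]).

    On $G_{n,m}$, vectors constant on each of the five cells $\{u\}$,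
    $\{v\}$, $\{w\}$, $\{x_i\}$, $\{y_j\}$ are stable under $B$
    ([mul_cell_vec]), and $\mathbf e_u$ is the sum of five such eigenvectors
    ([eigen_decomp]), for $\theta = 0, \pm 1, \pm 1/\sqrt 2$.  With
    $c = \sqrt{nm}/(n+m)$ their values at $w$ are $c/2$ for $\theta = 0$,
    $c/4$ for $\theta = \pm 1$ and $-c/2$ for $\theta = \pm 1/\sqrt 2$.
    The polynomial $T_4$ is $1$ at $0, \pm 1$ and $-1$ at $\pm 1/\sqrt 2$: all
    signs agree, and both sums are equal to $2c$.

    For $n = m$ this value is $1$; as $U$ is orthogonal, $U^4 N \mathbf e_u$ and
    $N \mathbf e_w$ are then unit vectors with inner product $1$, so they
    coincide ([perfect_state_transfer_walk_entry1]). *)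

Set Implicit Arguments.
Unset Strict Implicit.
Unset Printing Implicit Defensive.

(** * Chebyshev recurrence and orthogonality of the arc-reversal walk *)

Section ArcReversalWalk.
Variables (R : realType) (G : sgraph).
Hypothesis noiso : forall x : G, (0 < deg x)%N.

Local Notation N := (tail_mx R G).
Local Notation Rv := (reversal_mx R G).
Local Notation U := (transition_mx R G).
Local Notation B := (walk_mx R G).

Lemma tr_reversal_mx : Rv^T = Rv.
Proof.
apply/matrixP => i j; rewrite !mxE; congr (_%:R).
by case: (val (enum_val i)) (val (enum_val j)) => [a b] [c d]; rewrite !xpair_eqE
  (eq_sym c) (eq_sym d) andbC.
Qed.

Lemma reversal_mxK : Rv *m Rv = 1%:M.
Proof.
apply/matrixP => i j; pose a := enum_val i.
have ea : adj (val a).2 (val a).1 by rewrite adj_sym; exact: (valP a).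
pose b : garc G := exist (fun a : G * G => adj a.1 a.2) ((val a).2, (val a).1) ea.
rewrite mxE (bigD1 (enum_rank b)) //= big1 => [|k kb].
  rewrite addr0 !mxE enum_rankK -/a -surjective_pairing eqxx mul1r; congr (_%:R).
  rewrite /b /= xpair_eqE andbC -(inj_eq enum_val_inj) -/a -(inj_eq val_inj).
  by rewrite -xpair_eqE -!surjective_pairing.
rewrite !mxE; case: eqP => [e|]; last by rewrite mul0r.
case/eqP: kb; rewrite -(enum_valK k); congr enum_rank; apply: val_inj.
by rewrite /= e /= -surjective_pairing.
Qed.

Lemma transition_tail_mx : U *m N = Rv *m N.
Proof.
rewrite /transition_mx -mulmxA mulmxBl mul1mx -scalemxAl -mulmxA.
by rewrite (tail_mx_orthonormal R noiso) mulmx1 scaler_nat mulr2n addrK.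
Qed.

(** Half a step backwards: $N^T R U = N^T$, because $R^2 = 1$ and $N^TN = 1$. *)
Lemma tail_transition_mx t : N^T *m (Rv *m U ^+ t.+1) *m N = B t.
Proof.
rewrite exprS -[U * _]/(U *m _) /transition_mx !mulmxA -(mulmxA N^T Rv).
rewrite reversal_mxK mulmx1 mulmxBr mulmx1 -scalemxAr mulmxA.
by rewrite (tail_mx_orthonormal R noiso) mul1mx (scaler_nat _ N^T) mulr2n addrK.
Qed.

Lemma walk_mx0 : B 0 = 1%:M.
Proof. by rewrite /walk_mx expr0 mulmx1 (tail_mx_orthonormal R noiso). Qed.

Lemma walk_mx1E : B 1 = N^T *m Rv *m N.
Proof. by rewrite /walk_mx expr1 -mulmxA transition_tail_mx mulmxA. Qed.

(** The recurrence of the Chebyshev polynomials of the first kind; together with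
    [walk_mx0] it gives $B_t = T_t(B)$. *)
Lemma walk_mxSS t : B t.+2 = 2%:R *: (B 1 *m B t.+1) - B t.
Proof.
rewrite -(tail_transition_mx t) walk_mx1E /walk_mx.
set V := U ^+ t.+1.
rewrite exprS -[U * _]/(U *m V) /transition_mx.
rewrite mulmxBr mulmx1 mulmxBl mulmxBr mulmxBl -!scalemxAr -!scalemxAl.
rewrite -!scalemxAr -!scalemxAl.
by rewrite !mulmxA.
Qed.

(** $8\theta^4 - 8\theta^2 + 1$ is $T_4(\theta)$. *)
Lemma mulmx_walk4 th (v : 'rV_#|G|) : v *m B 1 = th *: v ->
  v *m B 4 = (8%:R * th ^+ 4 - 8%:R * th ^+ 2 + 1) *: v.
Proof.
move=> vB.
have v2 : v *m B 2 = (2%:R * th ^+ 2 - 1) *: v.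
  rewrite walk_mxSS mulmxBr walk_mx0 mulmx1 -scalemxAr mulmxA vB -scalemxAl vB.
  by rewrite !scalerA -[X in _ - X]scale1r -scalerBl; congr (_ *: _); ring.
have v3 : v *m B 3 = (4%:R * th ^+ 3 - 3%:R * th) *: v.
  rewrite walk_mxSS mulmxBr -scalemxAr mulmxA vB -scalemxAl v2.
  by rewrite !scalerA -scalerBl; congr (_ *: _); ring.
rewrite walk_mxSS mulmxBr -scalemxAr mulmxA vB -scalemxAl v3 v2.
by rewrite !scalerA -scalerBl; congr (_ *: _); ring.
Qed.

(** $R$ conjugates $U$ to its transpose. *)
Lemma tr_transition_mx : U^T *m Rv = Rv *m U.
Proof.
rewrite /transition_mx trmx_mul tr_reversal_mx -mulmxA reversal_mxK mulmx1.
by rewrite mulmxA reversal_mxK mul1mx linearB /= linearZ /= trmx1 trmx_mul trmxK.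
Qed.

Lemma tr_transition_mxX t : (U ^+ t)^T *m Rv = Rv *m U ^+ t.
Proof.
elim: t => [|t IH]; first by rewrite !expr0 trmx1 mul1mx mulmx1.
rewrite {1}exprSr -[_ * U]/(_ *m U) trmx_mul -mulmxA IH mulmxA tr_transition_mx.
by rewrite -(mulmxA Rv U) exprS.
Qed.

Lemma tr_walk_mx t : (B t)^T = B t.
Proof.
rewrite -[RHS]tail_transition_mx /walk_mx.
have NE : N = Rv *m (Rv *m N) by rewrite mulmxA reversal_mxK mul1mx.
(* Now (U^t)^T R = R U^t, and the outer factors R N = U N restore U^(t+1). *)
rewrite !trmx_mul trmxK [X in _ *m (_ *m X)]NE.
rewrite (mulmxA _ Rv (Rv *m N)) tr_transition_mxX.
by rewrite -transition_tail_mx exprSr -[_ * U]/(U ^+ t *m U) !mulmxA.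
Qed.

Lemma transition_mx_orthogonal : U^T *m U = 1%:M.
Proof.
have UE : U^T = (2%:R *: (N *m N^T) - 1%:M) *m Rv.
  rewrite /transition_mx trmx_mul tr_reversal_mx linearB /= linearZ /= trmx1.
  by rewrite trmx_mul trmxK.
have PP : N *m N^T *m (N *m N^T) = N *m N^T.
  by rewrite mulmxA -(mulmxA N) (tail_mx_orthonormal R noiso) mulmx1.
rewrite UE /transition_mx mulmxA -(mulmxA _ Rv Rv) reversal_mxK mulmx1.
rewrite mulmxBl mul1mx mulmxBr mulmx1 -scalemxAl -scalemxAr PP.
rewrite scalerA opprB addrCA -!scalerBl.
have -> : (2%:R * 2%:R - 2%:R - 2%:R : R) = 0 by ring.
by rewrite scale0r addr0.
Qed.

Lemma transition_mxX_orthogonal t : (U ^+ t)^T *m U ^+ t = 1%:M.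
Proof.
elim: t => [|t IH]; first by rewrite !expr0 trmx1 mul1mx.
rewrite exprS -[U * _]/(U *m _) trmx_mul -mulmxA (mulmxA U^T).
by rewrite transition_mx_orthogonal mul1mx.
Qed.

End ArcReversalWalk.

(** * Eigenprojections from an eigenvector decomposition *)

Section SpectralDecomposition.
Variables (R : realType) (G : sgraph).
Hypothesis noiso : forall x : G, (0 < deg x)%N.

Local Notation B := (walk_mx R G 1).

Lemma eigenvector_orthogonal (a b : R) (v w : 'rV_#|G|) : a != b ->
  v *m B = a *: v -> w *m B = b *: w -> v *m w^T = 0.
Proof.
move=> ab vB wB; have : a *: (v *m w^T) = b *: (v *m w^T).
  rewrite scalemxAl -vB -mulmxA -{1}(tr_walk_mx R noiso 1) -trmx_mul wB.
  by rewrite linearZ /= scalemxAr.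
by move/eqP; rewrite -subr_eq0 -scalerBl scaler_eq0 subr_eq0 (negPf ab) => /eqP.
Qed.

Lemma eigenvalue_eigenproj_entry (th : R) (x y : G) :
  eigenproj_entry th x y != 0 -> eigenvalue B th.
Proof.
apply: contraNT; rewrite /eigenvalue negbK => /eqP W0.
have : (eigenproj G th <= eigenspace B th)%MS.
  by rewrite -[eigenproj G th]mul1mx; exact: proj_mx_sub.
by rewrite W0 submx0 /eigenproj_entry => /eqP ->; rewrite mxE.
Qed.

(** A decomposition of $\mathbf e_x$ into eigenvectors of $B$, as a list of
    pairs (eigenvalue, row eigenvector) with distinct first components.  The
    vectors may be zero, in which case the first component need not be an
    eigenvalue. *)
Variables (s : seq (R * 'rV[R]_#|G|)) (x : G).
Hypothesis sB : forall p, p \in s -> p.2 *m B = p.1 *: p.2.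
Hypothesis s_uniq : uniq [seq p.1 | p <- s].
Hypothesis s_sum : \sum_(p <- s) p.2 = delta_mx 0 (enum_rank x).

Lemma eigenproj_entryE th y :
  eigenproj_entry th x y = \sum_(p <- s | p.1 == th) p.2 0 (enum_rank y).
Proof.
have -> : eigenproj_entry th x y =
    (delta_mx 0 (enum_rank x) *m eigenproj G th) (0 : 'I_1) (enum_rank y).
  by rewrite -rowE mxE.
rewrite -s_sum mulmx_suml summxE [RHS]big_mkcond big_seq [RHS]big_seq.
apply: eq_bigr => p ps; case: eqP => [<-|/eqP pth].
  by rewrite eigenproj_id //; apply/eigenspaceP; exact: sB.
rewrite eigenproj_0 ?mxE // => v vB.
exact: (eigenvector_orthogonal pth (sB ps) vB).
Qed.

Lemma eigenproj_entry_mem p y : p \in s ->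
  eigenproj_entry p.1 x y = p.2 0 (enum_rank y).
Proof.
rewrite eigenproj_entryE; elim: s s_uniq => //= q r IH /andP[qr r_uniq].
rewrite inE big_cons => /predU1P[->|pr].
  rewrite eqxx big_seq_cond big1 ?addr0 // => p' /andP[p'r /eqP e].
  by case/negP: qr; rewrite -e map_f.
by case: eqP => [e|_]; [case/negP: qr; rewrite e map_f | exact: IH].
Qed.

Lemma eigenproj_sumE y :
  eigenproj_sum R x y = \sum_(p <- s) `|p.2 0 (enum_rank y)|.
Proof.
transitivity (\sum_(th <- [seq p.1 | p <- s] | eigenvalue B th)
    `|eigenproj_entry th x y|).
  rewrite /eigenproj_sum; apply/esym/bigfs => // th _ ths.
  rewrite eigenproj_entryE big_seq_cond big1 ?normr0 // => p /andP[ps /eqP e].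
  by case/negP: ths; rewrite -e map_f.
rewrite big_map big_mkcond big_seq [RHS]big_seq; apply: eq_bigr => p ps.
case: ifPn => [_|]; first by rewrite eigenproj_entry_mem.
(* When p.1 is not an eigenvalue, its eigenspace is trivial and p.2 vanishes. *)
rewrite /eigenvalue negbK => /eqP W0.
have : (p.2 <= eigenspace B p.1)%MS by apply/eigenspaceP; exact: sB.
by rewrite W0 submx0 => /eqP ->; rewrite mxE normr0.
Qed.

Lemma walk_entry4E y : walk_entry R 4 x y =
  \sum_(p <- s) (8%:R * p.1 ^+ 4 - 8%:R * p.1 ^+ 2 + 1) * p.2 0 (enum_rank y).
Proof.
have -> : walk_entry R 4 x y =
    (delta_mx 0 (enum_rank x) *m walk_mx R G 4) (0 : 'I_1) (enum_rank y).
  by rewrite -rowE mxE.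
rewrite -s_sum mulmx_suml summxE big_seq [RHS]big_seq; apply: eq_bigr => p ps.
by rewrite (mulmx_walk4 noiso (sB ps)) mxE.
Qed.

End SpectralDecomposition.

(** * Perfect state transfer from a walk entry equal to one *)

Section PerfectStateTransfer.
Variables (R : realType) (G : sgraph).
Hypothesis noiso : forall x : G, (0 < deg x)%N.

Local Notation N := (tail_mx R G).
Local Notation U := (transition_mx R G).

Lemma mulmx_trl_eq0 n (z : 'cV[R]_n) : z^T *m z = 0 -> z = 0.
Proof.
move=> zz; apply/colP => i; rewrite [RHS]mxE.
move/matrixP/(_ 0 0)/eqP: zz; rewrite mxE [X in _ == X]mxE psumr_eq0.
  by move/allP/(_ i (mem_index_enum _)); rewrite /= mxE mulf_eq0 orbb => /eqP.
by move=> j _; rewrite mxE -expr2 sqr_ge0.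
Qed.

Lemma walk_entry_mulmx t (x y : G) : walk_entry R t x y =
  ((vertex_vec R x)^T *m walk_mx R G t *m vertex_vec R y) 0 0.
Proof. by rewrite /vertex_vec trmx_delta -rowE -colE [RHS]mxE [RHS]mxE. Qed.

Lemma perfect_state_transfer_walk_entry1 t (x y : G) : x != y ->
  walk_entry R t x y = 1 -> perfect_state_transfer R x y t.
Proof.
move=> xy Bxy; split=> //; exists 1; rewrite ?normr1 // scale1r.
congr map_mx; apply/eqP; rewrite -subr_eq0; apply/eqP/mulmx_trl_eq0.
set ex := vertex_vec R x; set ey := vertex_vec R y.
have e1 (v : G) : (vertex_vec R v)^T *m vertex_vec R v = 1%:M.
  by apply/matrixP => i j; rewrite !ord1 /vertex_vec trmx_delta mul_delta_mx !mxE.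
have NN v : (N *m vertex_vec R v)^T *m (N *m vertex_vec R v) = 1%:M.
  rewrite trmx_mul -!mulmxA (mulmxA N^T) (tail_mx_orthonormal R noiso) mul1mx.
  exact: e1.
have XX : (U ^+ t *m N *m ex)^T *m (U ^+ t *m N *m ex) = 1%:M.
  rewrite -(mulmxA _ N) trmx_mul -(mulmxA (N *m ex)^T) (mulmxA (U ^+ t)^T).
  by rewrite (transition_mxX_orthogonal R noiso) mul1mx NN.
have YX : (N *m ey)^T *m (U ^+ t *m N *m ex) = 1%:M.
  apply: trmx_inj; rewrite trmx1; apply/matrixP => i j; rewrite !ord1 [RHS]mxE.
  rewrite -[RHS]Bxy walk_entry_mulmx -/ex -/ey -(tr_walk_mx R noiso t).
  rewrite /walk_mx !trmx_mul !trmxK; congr (fun_of_matrix _ 0 0).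
  by rewrite !mulmxA.
have XY : (U ^+ t *m N *m ex)^T *m (N *m ey) = 1%:M.
  by apply: trmx_inj; rewrite trmx_mul trmxK YX trmx1.
by rewrite [(_ - _)^T]linearB /= mulmxBl !mulmxBr XX (NN y) YX XY subrr.
Qed.

End PerfectStateTransfer.

(** * The five cells of the graph *)

Lemma sum_Gvert (V : nmodType) n m (F : Gvert n m -> V) :
  \sum_z F z = F vu + F vv + F vw + \sum_i F (vx i) + \sum_j F (vy j).
Proof.
rewrite !big_sumType /= !big_ord_recl big_ord0 addr0 !addrA.
by do ![congr (_ + _)]; congr F; congr inl; apply: val_inj.
Qed.

Section CellVectors.
Variables (R : realType) (n m : nat).
Hypotheses (n_gt0 : (0 < n)%N) (m_gt0 : (0 < m)%N).

Local Notation G := (Ggraph n m).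
Local Notation B := (walk_mx R G 1).

Lemma deg_sum (z : G) : deg z = \sum_(z' : Gvert n m) (Gadj z z' : nat).
Proof.
rewrite /deg -sum1dep_card big_mkcond /=; apply: eq_bigr => z' _.
by case: Gadj.
Qed.

Lemma degE : [/\ deg (vu : G) = n, deg (vv : G) = (n + m)%N, deg (vw : G) = m,
  forall i, deg (vx i : G) = 2%N & forall j, deg (vy j : G) = 2%N].
Proof.
by split=> [||| i | j]; rewrite deg_sum sum_Gvert /= !sum_nat_const !card_ord;
   rewrite ?muln0 ?muln1 ?addr0 ?add0r.
Qed.

(** The row vector that is constant on each of the cells $\{u\}$, $\{v\}$,
    $\{w\}$, $\{x_i\}$, $\{y_j\}$, with the given values in this order. *)
Definition cell_vec (fu fv fw fx fy : R) : 'rV[R]_#|G| :=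
  \row_k match enum_val k : Gvert n m with
         | inl i => [:: fu; fv; fw]`_i
         | inr (inl _) => fx
         | inr (inr _) => fy
         end.

Local Notation p := (Num.sqrt n%:R : R).
Local Notation q := (Num.sqrt m%:R : R).
Local Notation r := (Num.sqrt (n + m)%:R : R).
Local Notation s := (Num.sqrt 2%:R : R).

Lemma cell_vec_eq (v : 'rV[R]_#|G|) fu fv fw fx fy :
  v 0 (enum_rank (vu : G)) = fu -> v 0 (enum_rank (vv : G)) = fv ->
  v 0 (enum_rank (vw : G)) = fw -> (forall i, v 0 (enum_rank (vx i : G)) = fx) ->
  (forall j, v 0 (enum_rank (vy j : G)) = fy) -> v = cell_vec fu fv fw fx fy.
Proof.
move=> hu hv hw hx hy; apply/rowP => k; rewrite mxE -[in LHS](enum_valK k).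
case: (enum_val k : Gvert n m) => [[[|[|[|//]]] i3]|[i|j]] /=.
- by rewrite -hu; congr (v 0 (enum_rank _)); congr inl; apply: val_inj.
- by rewrite -hv; congr (v 0 (enum_rank _)); congr inl; apply: val_inj.
- by rewrite -hw; congr (v 0 (enum_rank _)); congr inl; apply: val_inj.
- exact: hx.
- exact: hy.
Qed.

Let sqrtn_neq0 k : (0 < k)%N -> Num.sqrt k%:R != 0 :> R.
Proof. by move=> k_gt0; rewrite sqrtr_eq0 -ltNge ltr0n. Qed.

Let p_neq0 : p != 0. Proof. exact: sqrtn_neq0. Qed.
Let q_neq0 : q != 0. Proof. exact: sqrtn_neq0. Qed.
Let r_neq0 : r != 0. Proof. by apply: sqrtn_neq0; rewrite addn_gt0 n_gt0. Qed.
Let s_neq0 : s != 0. Proof. exact: sqrtn_neq0. Qed.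
Let r2 : r ^+ 2 = p ^+ 2 + q ^+ 2.
Proof. by rewrite !sqr_sqrtr ?ler0n // natrD. Qed.
Let s2 : s ^+ 2 = 2%:R.
Proof. by rewrite sqr_sqrtr ?ler0n. Qed.

(** The action of $B$ on these vectors.  The multiplicities $n$ and $m$ of the
    last two cells appear as $p^2$ and $q^2$, so that [field] can treat $p$,
    $q$, $r$, $s$ as atoms. *)
Lemma mul_cell_vec fu fv fw fx fy :
  cell_vec fu fv fw fx fy *m B =
  cell_vec (p ^+ 2 * fx / (p * s)) ((p ^+ 2 * fx + q ^+ 2 * fy) / (r * s))
           (q ^+ 2 * fy / (q * s)) (fu / (p * s) + fv / (r * s))
           (fv / (r * s) + fw / (q * s)).
Proof.
have BE z : (cell_vec fu fv fw fx fy *m B) 0 (enum_rank (z : G)) =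
    \sum_(z' : G) cell_vec fu fv fw fx fy 0 (enum_rank z') *
      ((adj z' z)%:R / (Num.sqrt (deg z')%:R * Num.sqrt (deg z)%:R)).
  rewrite mxE (reindex (@enum_rank G)) /=; last exact/onW_bij/enum_rank_bij.
  apply: eq_bigr => z' _; congr (_ * _); apply: walk_entry1 => z''.
  exact: Ggraph_deg_gt0.
have [du dv dw dx dy] := degE.
have cst k (c : R) : \sum_(i < k) c = Num.sqrt k%:R ^+ 2 * c.
  by rewrite sumr_const card_ord sqr_sqrtr ?ler0n // mulr_natl.
apply: cell_vec_eq => [|||i|j]; rewrite BE sum_Gvert !mxE !enum_rankK /=;
  under eq_bigr do rewrite mxE enum_rankK dx /=;
  under [X in _ + X]eq_bigr do rewrite mxE enum_rankK dy /=;
  rewrite ?du ?dv ?dw ?dx ?dy !cst.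
all: by field; rewrite ?p_neq0 ?q_neq0 ?r_neq0 ?s_neq0.
Qed.

Lemma scale_cell_vec (c : R) fu fv fw fx fy :
  c *: cell_vec fu fv fw fx fy =
  cell_vec (c * fu) (c * fv) (c * fw) (c * fx) (c * fy).
Proof. by apply: cell_vec_eq => [|||i|j]; rewrite !mxE enum_rankK. Qed.

Lemma add_cell_vec fu fv fw fx fy gu gv gw gx gy :
  cell_vec fu fv fw fx fy + cell_vec gu gv gw gx gy =
  cell_vec (fu + gu) (fv + gv) (fw + gw) (fx + gx) (fy + gy).
Proof. by apply: cell_vec_eq => [|||i|j]; rewrite !mxE enum_rankK. Qed.

Lemma delta_mx_cell_vec :
  delta_mx 0 (enum_rank (vu : G)) = cell_vec 1 0 0 0 0.
Proof. by apply: cell_vec_eq => [|||i|j]; rewrite mxE (inj_eq enum_rank_inj). Qed.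

(** The component of $\mathbf e_u$ for the eigenvalue [e], where [e] is $1$ or
    $-1$. *)
Definition eigvec_pm1 (e : R) : 'rV[R]_#|G| :=
  cell_vec (p ^+ 2 / (4%:R * r ^+ 2)) (p / (4%:R * r)) (p * q / (4%:R * r ^+ 2))
    (e * p / (2%:R * s * r ^+ 2)) (e * p / (2%:R * s * r ^+ 2)).

(** The component of $\mathbf e_u$ for the eigenvalue $e/\sqrt 2$, where [e] is
    $1$ or $-1$. *)
Definition eigvec_pmV2 (e : R) : 'rV[R]_#|G| :=
  cell_vec (q ^+ 2 / (2%:R * r ^+ 2)) 0 (- (p * q / (2%:R * r ^+ 2)))
    (e * q ^+ 2 / (2%:R * p * r ^+ 2)) (- (e * p / (2%:R * r ^+ 2))).

(** The component of $\mathbf e_u$ in the kernel of $B$. *)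
Definition eigvec_0 : 'rV[R]_#|G| :=
  cell_vec (p ^+ 2 / (2%:R * r ^+ 2)) (- (p / (2%:R * r)))
    (p * q / (2%:R * r ^+ 2)) 0 0.

(** The components of $\mathbf e_u$ paired with their eigenvalues, in increasing
    order. *)
Definition eigen_decomp : seq (R * 'rV[R]_#|G|) :=
  [:: (-1, eigvec_pm1 (-1)); (- s^-1, eigvec_pmV2 (-1)); (0, eigvec_0);
      (s^-1, eigvec_pmV2 1); (1, eigvec_pm1 1)].

Lemma eigen_decomp_eigen pv : pv \in eigen_decomp -> pv.2 *m B = pv.1 *: pv.2.
Proof.
have neq0 := (p_neq0, q_neq0, r_neq0, s_neq0).
by rewrite !inE => /or4P[|||/orP[]] /eqP -> /=;
  rewrite mul_cell_vec scale_cell_vec; congr cell_vec; field: r2 s2; rewrite ?neq0.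
Qed.

Lemma eigen_decomp_uniq : uniq [seq pv.1 | pv <- eigen_decomp].
Proof.
apply: lt_sorted_uniq => /=.
have s1 : 1 < s by rewrite -[ltLHS]sqrtr1 ltr_sqrt ?ltr1n.
have s_inv0 : 0 < s^-1 by rewrite invr_gt0 (lt_trans ltr01).
have s_inv1 : s^-1 < 1 by rewrite invf_lt1 // (lt_trans ltr01).
by rewrite ltrN2 oppr_lt0 s_inv0 s_inv1.
Qed.

Lemma eigen_decomp_sum :
  \sum_(pv <- eigen_decomp) pv.2 = delta_mx 0 (enum_rank (vu : G)).
Proof.
rewrite /eigen_decomp !big_cons big_nil /= addr0 !add_cell_vec delta_mx_cell_vec.
have neq0 := (p_neq0, q_neq0, r_neq0, s_neq0).
by congr cell_vec; field: r2 s2; rewrite ?neq0.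
Qed.

(** * State transfer from u to w *)

Lemma cell_vec_vw fu fv fw fx fy :
  cell_vec fu fv fw fx fy 0 (enum_rank (vw : G)) = fw.
Proof. by rewrite mxE enum_rankK. Qed.

Let amplitudeE : 2%:R * Num.sqrt (n * m)%:R / (n + m)%:R = 2%:R * (p * q) / r ^+ 2.
Proof. by rewrite natrM sqrtrM ?ler0n // sqr_sqrtr ?ler0n. Qed.

Lemma eigenproj_sum_vu_vw : eigenproj_sum R (vu : G) vw =
  2%:R * Num.sqrt (n * m)%:R / (n + m)%:R.
Proof.
have noiso (z : G) : (0 < deg z)%N by exact: Ggraph_deg_gt0.
rewrite (eigenproj_sumE noiso eigen_decomp_eigen eigen_decomp_uniq
  eigen_decomp_sum) amplitudeE.
rewrite /eigen_decomp !big_cons big_nil /= !cell_vec_vw addr0 normrN !ger0_norm //.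
  by field; rewrite r_neq0.
all: by rewrite ?divr_ge0 ?mulr_ge0 ?exprn_ge0 ?sqrtr_ge0 ?ler0n.
Qed.

Lemma walk_entry4_vu_vw : walk_entry R 4 (vu : G) vw =
  2%:R * Num.sqrt (n * m)%:R / (n + m)%:R.
Proof.
have noiso (z : G) : (0 < deg z)%N by exact: Ggraph_deg_gt0.
rewrite (walk_entry4E noiso eigen_decomp_eigen eigen_decomp_sum) amplitudeE.
rewrite /eigen_decomp !big_cons big_nil /= !cell_vec_vw addr0.
by field: s2; rewrite r_neq0 s_neq0.
Qed.

Lemma peak_state_transfer_vu_vw : peak_state_transfer R (vu : G) vw 4.
Proof.
have noiso (z : G) : (0 < deg z)%N by exact: Ggraph_deg_gt0.
have E0 : eigenproj_entry (0 : R) (vu : G) vw != 0.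
  have in0 : (0, eigvec_0) \in eigen_decomp by rewrite !inE eqxx !orbT.
  rewrite (eigenproj_entry_mem noiso eigen_decomp_eigen eigen_decomp_uniq
    eigen_decomp_sum _ in0).
  by rewrite cell_vec_vw !mulf_neq0 ?invr_neq0 ?mulf_neq0 ?expf_neq0.
split=> //.
  by rewrite walk_entry4_vu_vw eigenproj_sum_vu_vw ger0_norm.
by exists 0 => //; exact: (eigenvalue_eigenproj_entry E0).
Qed.

End CellVectors.

(** * The graphs with consecutive parameters *)

Lemma amplitude_consecutive (R : realType) n :
  2%:R * Num.sqrt (n * n.+1)%:R / (n + n.+1)%:R =
  Num.sqrt (1 - 1 / (2 * n + 1)%:R ^+ 2) :> R.
Proof.
have -> : (n + n.+1)%:R = (2 * n + 1)%:R :> R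
  by congr (_%:R); rewrite mul2n -addnn addn1 addnS.
have k0 : 0 < (2 * n + 1)%:R :> R by rewrite ltr0n addn1.
apply/esym/eqP; rewrite -(eqrXn2 (n := 2)) ?sqrtr_ge0 //.
rewrite sqr_sqrtr; last first.
  by rewrite subr_ge0 div1r invf_le1 ?exprn_gt0 // -natrX ler1n expn_gt0 addn1.
rewrite exprMn exprMn sqr_sqrtr ?ler0n //; apply/eqP.
rewrite !natrM natrD natrM -addn1 natrD; field.
by rewrite -natrM natr1 pnatr_eq0.
Qed.

Lemma cvg_sqrt_amplitude (R : realType) :
  Num.sqrt (1 - 1 / (2 * n + 1)%:R ^+ 2) @[n --> \oo] --> (1 : R).
Proof.
rewrite -[X in _ --> X]sqrtr1.
apply: continuous_cvg; first exact: sqrt_continuous.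
rewrite -[X in _ --> X]subr0; apply: cvgB; first exact: cvg_cst.
apply: (@squeeze_cvgr _ _ _ _ (fun=> 0) (@harmonic R));
  [|exact: cvg_cst|exact: cvg_harmonic].
(* The harmonic sequence is 1 / (n + 1), whence the bound n + 1 <= (2n + 1)^2. *)
apply: nearW => n; rewrite divr_ge0 ?exprn_ge0 //= div1r.
rewrite lef_pV2 ?posrE ?exprn_gt0 ?ltr0n ?addn1 // -natrX ler_nat.
by apply: (@leq_trans (2 * n).+1); [rewrite ltnS leq_pmull|exact: leq_pmulr].
Qed.

Theorem mainTheorem8 (R : realType) :
  [/\ forall n m : nat, (1 <= n)%N -> (1 <= m)%N ->
        [/\ peak_state_transfer R (vu : Ggraph n m) vw 4,
            `|walk_entry R 4 (vu : Ggraph n m) vw|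
              = eigenproj_sum R (vu : Ggraph n m) vw
          & eigenproj_sum R (vu : Ggraph n m) vw
              = 2%:R * Num.sqrt (n * m)%:R / (n + m)%:R],
      forall n m : nat, (1 <= n)%N -> (1 <= m)%N -> n = m ->
        perfect_state_transfer R (vu : Ggraph n m) vw 4,
      forall n : nat, (1 <= n)%N ->
        walk_entry R 4 (vu : Ggraph n n.+1) vw
          = Num.sqrt (1 - 1 / (2 * n + 1)%:R ^+ 2)
    & walk_entry R 4 (vu : Ggraph n n.+1) vw @[n --> \oo] --> (1 : R)].
Proof.
have consec n : (1 <= n)%N -> walk_entry R 4 (vu : Ggraph n n.+1) vw
    = Num.sqrt (1 - 1 / (2 * n + 1)%:R ^+ 2).
  by move=> n0; rewrite walk_entry4_vu_vw // amplitude_consecutive.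
split=> [n m n0 m0|n m n0 m0 nm||] //.
- have peak := peak_state_transfer_vu_vw R n0 m0.
  by split=> //; [case: peak | exact: eigenproj_sum_vu_vw].
- have noiso (z : Ggraph n m) : (0 < deg z)%N by exact: Ggraph_deg_gt0.
  apply: (perfect_state_transfer_walk_entry1 noiso) => //.
  rewrite walk_entry4_vu_vw // -nm natrM -expr2 sqrtr_sqr ger0_norm //.
  by rewrite addnn -mul2n natrM divff // mulf_neq0 // pnatr_eq0 -lt0n.
(* The formula needs n >= 1, so the sequences agree only eventually. *)
- apply: cvg_trans (@cvg_sqrt_amplitude R); apply: near_eq_cvg.
  by near=> n; rewrite consec //; near: n; exact: nbhs_infty_ge.
Unshelve. all: by end_near. Qed.
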